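(* Let $k$ be an algebraically closed field and let $A$ be a $k$-algebra which is generated by an abelian group $\Gamma$ of units of $A$ together with finitely many elements $a_1,\dots,a_\theta$, such that there are non-trivial characters $\chi_1,\dots,\chi_\theta\in\widehat\Gamma$ with $$g a_i g^{-1}=\chi_i(g)a_i\quad\text{for all } g\in\Gamma,\ 1\le i\le\theta .$$ Suppose that $\Gamma$ and $(\chi_i)_{1\le i\le\theta}$ are part of a datum $\mathcal D=\mathcal D(\Gamma,(g_i)_{1\le i\le\theta},(\chi_i)_{1\le i\le\theta},(a_{ij})_{1\le i,j\le\theta})$ of finite Cartan type. Suppose that none of the $q_i=\chi_i(g_i)$, $1\le i\le\theta$, is a root of unity, and that whenever $1\le i,j\le\theta$ are in different connected components of $\{1,\dots,\theta\}$, the elements $a_i$ and $a_j$ skew commute. Then finite-dimensional simple left $A$-modules are one-dimensional.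
   Context: $\widehat\Gamma$ is the group of characters of $\Gamma$ with values in $k^\times$. Elements $a,b$ of an algebra skew commute if $ab=\omega ba$ for some non-zero $\omega\in k$. A datum of Cartan type $\mathcal D(\Gamma,(g_i),(\chi_i),(a_{ij}))$ consists of an abelian group $\Gamma$, elements $g_i\in\Gamma$ and characters $\chi_i\in\widehat\Gamma$ ($1\le i\le\theta$), and a $\theta\times\theta$ generalized Cartan matrix $(a_{ij})$ (integer entries, $a_{ii}=2$, $a_{ij}\le0$ for $i\ne j$, and $a_{ij}=0$ implies $a_{ji}=0$) such that, with $q_{ij}=\chi_j(g_i)$, $$q_{ij}q_{ji}=q_{ii}^{a_{ij}},\qquad q_{ii}\ne1\qquad\text{for all }1\le i,j\le\theta .$$ One writes $q_i=q_{ii}$. The datum is of finite Cartan type if $(a_{ij})$ is a Cartan matrix of finite type. $i$ is connected to $j$ if there are indices $i=i_1,\dots,i_t=j$, $t\ge2$, with $a_{i_li_{l+1}}\ne0$ for all $1\le l<t$; this is an equivalence relation on $\{1,\dots,\theta\}$ whose classes are the connected components. *)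

(* Defs.v *)
From HB Require Import structures.
From mathcomp Require Import all_boot all_order all_algebra.
Set Implicit Arguments.
Unset Strict Implicit.
Unset Printing Implicit Defensive.
Import Order.TTheory GRing.Theory Num.Theory.
Local Open Scope ring_scope.

Definition abelian_group (Gamma : groupType) : Prop :=
  forall x y : Gamma, (x * y = y * x)%g.

(* [chi 1 = 1] follows from these two conditions. *)
Definition is_character (k : fieldType) (Gamma : groupType)
    (chi : Gamma -> k) : Prop :=
  (forall x, chi x != 0) /\ (forall x y, chi (x * y)%g = chi x * chi y).

Definition nontrivial_character (k : fieldType) (Gamma : groupType)
    (chi : Gamma -> k) : Prop :=
  is_character chi /\ exists x, chi x != 1.

Definition generalized_cartan_matrix (theta : nat) (C : 'M[int]_theta) : Prop :=
  [/\ forall i, C i i = 2,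
      forall i j, i != j -> C i j <= 0
    & forall i j, C i j = 0 -> C j i = 0].

(* [C] is symmetrizable and its symmetrization is positive definite. As [C] has
   integer entries, testing this over the rationals or over the reals is the
   same thing. *)
Definition finite_type_cartan_matrix (theta : nat) (C : 'M[int]_theta) : Prop :=
  generalized_cartan_matrix C /\
  exists d : 'rV[rat]_theta,
    let S : 'M[rat]_theta := diag_mx d *m map_mx intr C in
    [/\ forall i, 0 < d 0 i,
        S^T = S
      & forall x : 'cV[rat]_theta, x != 0 -> 0 < (x^T *m S *m x) 0 0].

Section CartanDatum.
Variables (k : fieldType) (Gamma : groupType) (theta : nat).
Variables (g : 'I_theta -> Gamma) (chi : 'I_theta -> Gamma -> k).

Definition braiding (i j : 'I_theta) : k := chi j (g i).

Definition datum_of_cartan_type (C : 'M[int]_theta) : Prop :=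
  [/\ abelian_group Gamma,
      forall i, is_character (chi i),
      generalized_cartan_matrix C,
      forall i j, braiding i j * braiding j i = braiding i i ^ C i j
    & forall i, braiding i i != 1].

Definition datum_of_finite_cartan_type (C : 'M[int]_theta) : Prop :=
  datum_of_cartan_type C /\ finite_type_cartan_matrix C.

End CartanDatum.

(* [connect] also allows the path of length zero from [i] to [i]; since
   [C i i = 2 != 0] this does not enlarge the relation. *)
Definition connected (theta : nat) (C : 'M[int]_theta) : rel 'I_theta :=
  connect (fun i j => C i j != 0).

Definition is_root_of_unity (k : fieldType) (q : k) : Prop :=
  exists2 n : nat, (0 < n)%N & n.-unity_root q.

Section Algebras.
Variables (k : fieldType) (A : algType k).

Definition skew_commute (a b : A) : Prop :=
  exists2 omega : k, omega != 0 & a * b = omega *: (b * a).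

(* Presents [Gamma] as a group of units of [A], namely the image of [u];
   invertibility of [u x] is automatic, with inverse [u x^-1]. *)
Definition embeds_in_units (Gamma : groupType) (u : Gamma -> A) : Prop :=
  [/\ injective u, u 1%g = 1 & forall x y, u (x * y)%g = u x * u y].

Definition generated_by (Gamma : groupType) (u : Gamma -> A)
    (theta : nat) (a : 'I_theta -> A) : Prop :=
  forall S : {pred A}, GRing.subalg_closed S ->
    (forall x, u x \in S) -> (forall i, a i \in S) -> forall b, b \in S.

Definition simple_module (M : lmodType A) : Prop :=
  (exists v : M, v != 0) /\
  forall S : {pred M}, GRing.submod_closed S ->
    (forall v, v \in S -> v = 0) \/ (forall v, v \in S).

(* The k-vector space underlying a left A-module. *)
Definition restrict_scalars (M : lmodType A) : Type := M.

HB.instance Definition _ (M : lmodType A) :=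
  GRing.Zmodule.on (restrict_scalars M).

Section RestrictScalars.
Variable M : lmodType A.

Definition restricted_scale (c : k) (v : restrict_scalars M) :
  restrict_scalars M := c%:A *: (v : M).

Fact restricted_scaleA b c v :
  restricted_scale b (restricted_scale c v) = restricted_scale (b * c) v.
Proof. by rewrite /restricted_scale scalerA mulr_algl scalerA. Qed.

Fact restricted_scale1 : left_id 1 restricted_scale.
Proof. by move=> v; rewrite /restricted_scale !scale1r. Qed.

Fact restricted_scaleDr : right_distributive restricted_scale +%R.
Proof. by move=> c v w; rewrite /restricted_scale scalerDr. Qed.

Fact restricted_scaleDl v : {morph restricted_scale^~ v : b c / b + c}.
Proof. by move=> b c; rewrite /restricted_scale !scalerDl. Qed.

HB.instance Definition _ :=
  GRing.Zmodule_isLmodule.Build k (restrict_scalars M)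
    restricted_scaleA restricted_scale1 restricted_scaleDr restricted_scaleDl.

End RestrictScalars.

Definition has_dimension (M : lmodType A) (n : nat) : Prop :=
  inhabited (Vector.axiom n (restrict_scalars M)).

Definition finite_dimensional (M : lmodType A) : Prop :=
  exists n : nat, has_dimension M n.

End Algebras.

(* Main.v *)
(* Let [J] be a connected component and suppose that no nonzero vector of the
   simple module [M] is killed by all [a_j], [j] in [J].  Starting from a common
   eigenvector of [Gamma] one can then apply such [a_j] forever, obtaining
   nonzero weight vectors whose weights differ by products of characters
   [chi_j], [j] in [J].  Such a nonempty product is never trivial: if it were,
   evaluating it on the product of the corresponding [g_j] would give
   [prod_(i, j) q_ij = 1] over the letters of a word, hence
   [prod_(i, j) q_ii ^ a_ij = 1]; as all [q_ii], [i] in [J], are commensurable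
   powers of a single one, this reads [q_i0 ^ (N * s) = 1] with [s] a value of
   the positive definite form of the Cartan matrix.  Weight vectors of distinct
   weights being independent, this contradicts finite dimension.  So the common
   kernel of the [a_j], [j] in [J], is nonzero; by skew commutation it is a
   submodule, hence all of [M].  Thus every [a_i] acts as zero, and the line
   spanned by a weight vector is a submodule. *)

Require Import Defs.
From HB Require Import structures.
From mathcomp Require Import all_boot all_order all_algebra.
From mathcomp Require Import boolp ring.
Set Implicit Arguments.
Unset Strict Implicit.
Unset Printing Implicit Defensive.
Import Order.TTheory GRing.Theory Num.Theory.
Local Open Scope ring_scope.

(** * Integral form of a finite Cartan matrix, evaluated on words *)

(** The vector [x] records how often each letter occurs in [w], so positive definiteness of [S] can
    be applied to double sums over words. *)
Lemma quadratic_form_word (R : comNzRingType) (n : nat) (S : 'M[R]_n)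
    (w : seq 'I_n) :
  let x : 'cV[R]_n := \sum_(i <- w) delta_mx i 0 in
  (x^T *m S *m x) 0 0 = \sum_(i <- w) \sum_(j <- w) S i j.
Proof.
move=> x; have -> : x^T = \sum_(i <- w) (delta_mx i 0)^T by rewrite linear_sum.
rewrite !mulmx_suml summxE.
apply: eq_bigr => i _; rewrite trmx_delta -rowE mulmx_sumr summxE.
by apply: eq_bigr => j _; rewrite -colE !mxE.
Qed.

(** Clearing the denominators of the rational symmetrizer makes its entries usable as exponents in
    the field. *)
Lemma integral_symmetrizer (theta : nat) (C : 'M[int]_theta) :
  finite_type_cartan_matrix C ->
  exists e : 'I_theta -> int,
    [/\ forall i, 0 < e i,
        forall i j, e i * C i j = e j * C j i
      & forall w, w != [::] ->
          0 < \sum_(i <- w) \sum_(j <- w) e i * C i j].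
Proof.
case=> _ [d [d_gt0 symS posS]].
pose D : int := \prod_i denq (d 0 i).
have D_gt0 : 0 < D by apply: prodr_gt0 => i _; apply: denq_gt0.
pose e i : int := numq (d 0 i) * \prod_(j | j != i) denq (d 0 j).
have eE i : (e i)%:~R = D%:~R * d 0 i :> rat.
  by rewrite /e /D [in RHS](bigD1 i) //= !rmorphM /= numqE; ring.
have SE i j : (e i * C i j)%:~R =
    D%:~R * (diag_mx d *m map_mx intr C) i j :> rat.
  by rewrite rmorphM /= eE mul_diag_mx !mxE mulrA.
exists e; split=> [i|i j|w w_neq0].
- by rewrite -(ltr0z rat) eE mulr_gt0 ?ltr0z.
- apply/eqP; rewrite -(eqr_int rat); apply/eqP.
  by rewrite !SE -[in LHS]symS mxE.
- rewrite -(ltr0z rat) raddf_sum /=.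
  under eq_bigr => i _.
    rewrite raddf_sum /=; under eq_bigr do rewrite SE.
    rewrite -mulr_sumr; over.
  rewrite -mulr_sumr mulr_gt0 ?ltr0z // -quadratic_form_word posS //.
  (* The multiplicity vector is nonzero: its entry at the first letter [h] is at least 1. *)
  case: w w_neq0 => // h w _; apply/eqP => /matrixP/(_ h 0)/eqP.
  rewrite big_cons mxE summxE !mxE !eqxx gt_eqF // ltr_pwDl //.
  apply: sumr_ge0 => i _.
  by rewrite mxE ler0n.
Qed.

(** * Braidings of Cartan type along a connected component *)

Section CartanBraiding.
Variables (k : fieldType) (theta : nat) (C : 'M[int]_theta).
Variable q : 'I_theta -> 'I_theta -> k.
Hypothesis q_neq0 : forall i j, q i j != 0.
Hypothesis q_cartan : forall i j, q i j * q j i = q i i ^ C i j.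
Variable e : 'I_theta -> int.
Hypothesis e_gt0 : forall i, 0 < e i.
Hypothesis e_sym : forall i j, e i * C i j = e j * C j i.

(** Along an edge, [q i i ^ C i j = q i j * q j i = q j j ^ C j i]. Heuristically [q i i] is a
    common base raised to [e i]; the exponent [N] avoids extracting roots. *)
Lemma connected_commensurable i j : connected C i j ->
  exists2 N : int, N != 0 & q j j ^ (e i * N) = q i i ^ (e j * N).
Proof.
case/connectP=> p; elim/last_ind: p j => [|p l IHp] j /=.
  by move=> _ ->; exists 1.
rewrite rcons_path last_rcons => /andP[path_p C_neq0] -> {j}.
have [N N_neq0 qN] := IHp _ path_p erefl.
set j := last i p in C_neq0 qN.
(* By symmetry [e j * C j l] equals [e l * C l j], and the factor [C l j] lets [qjl] replace [q l l]
   by [q j j]. *)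
exists (e j * C j l * N); first by rewrite !mulf_neq0 // gt_eqF.
have qjl : q j j ^ C j l = q l l ^ C l j by rewrite -!q_cartan mulrC.
rewrite e_sym.
have -> : e i * (e l * C l j * N) = C l j * (e l * e i * N) by ring.
rewrite -exprz_exp -qjl exprz_exp.
have -> : C j l * (e l * e i * N) = e i * N * (C j l * e l) by ring.
by rewrite -exprz_exp qN exprz_exp; congr (_ ^ _); rewrite -e_sym; ring.
Qed.

Lemma prod_expfz (I : Type) (r : seq I) (x : k) (f : I -> int) : x != 0 ->
  \prod_(i <- r) x ^ f i = x ^ (\sum_(i <- r) f i).
Proof.
move=> x_neq0; elim: r => [|i r IHr]; first by rewrite !big_nil expr0z.
by rewrite !big_cons IHr expfzDr.
Qed.

Lemma expfz_prod (I : Type) (r : seq I) (x : I -> k) (n : int) :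
  \prod_(i <- r) x i ^ n = (\prod_(i <- r) x i) ^ n.
Proof.
elim: r => [|i r IHr]; first by rewrite !big_nil exp1rz.
by rewrite !big_cons IHr expfzMl.
Qed.

Hypothesis e_pos : forall w, w != [::] ->
  0 < \sum_(i <- w) \sum_(j <- w) e i * C i j.

(** For [q i j = chi j (g i)], this says that the product of the characters along [w] is nontrivial
    already at one of the [g i]. *)
Lemma connected_word_nontrivial i0 (w : seq 'I_theta) :
    ~ is_root_of_unity (q i0 i0) -> w != [::] -> all (connected C i0) w ->
  exists i, \prod_(j <- w) q i j != 1.
Proof.
move=> q_not_root w_neq0 /allP w_conn; apply/existsP/contraT.
rewrite negb_exists => /forallP /= q1.
have {}q1 i : \prod_(j <- w) q i j = 1 by apply/eqP; rewrite -[_ == _]negbK.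
(* One exponent is chosen per index, with filler 1 outside the component; their product [N] then
   serves all letters at once. *)
have : exists f : 'I_theta -> int, forall i, f i != 0 /\ (connected C i0 i ->
    q i i ^ (e i0 * f i) = q i0 i0 ^ (e i * f i)).
  apply: (@fin_all_exists _ (fun=> int) (fun i N => N != 0 /\
    (connected C i0 i -> q i i ^ (e i0 * N) = q i0 i0 ^ (e i * N)))) => i.
  have [/connected_commensurable[N]|] := boolP (connected C i0 i).
    by exists N.
  by exists 1.
case=> f fP; pose N := \prod_i f i.
have N_neq0 : N != 0 by apply/prodf_neq0 => i _; have [] := fP i.
have qN i : i \in w -> q i i ^ (e i0 * N) = q i0 i0 ^ (N * e i).
  move=> /w_conn /(proj2 (fP i)) qf; rewrite /N (bigD1 i) //= !mulrA.
  by rewrite -exprz_exp qf exprz_exp; congr (_ ^ _); ring.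
pose s := \sum_(i <- w) \sum_(j <- w) e i * C i j.
have qs : q i0 i0 ^ (N * s) = 1.
  (* Both halves of the symmetrized product are products of the row products in [q1], the second
     after exchanging [i] and [j]. *)
  have : (\prod_(i <- w) \prod_(j <- w) (q i j * q j i)) ^ (e i0 * N) = 1.
    under eq_bigr do rewrite big_split /=.
    rewrite big_split /= [X in _ * X]exchange_big /=.
    by rewrite big1 ?mul1r ?exp1rz // => i _; rewrite q1.
  move=> <-; rewrite -expfz_prod /s mulr_sumr -prod_expfz //.
  apply: eq_big_seq => i iw.
  rewrite -expfz_prod mulr_sumr -prod_expfz //; apply: eq_bigr => j _.
  by rewrite q_cartan exprzAC qN // exprz_exp; congr (_ ^ _); ring.
have: N * s != 0 by rewrite mulf_neq0 // gt_eqF ?e_pos.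
(* [N] may be negative; then the relation is inverted to get a positive exponent. *)
case: (intP (N * s)) qs => [|n|n] qs // _; case: q_not_root; exists n.+1 => //.
  exact/unity_rootP.
apply/unity_rootP; move/eqP: qs.
by rewrite -invr_expz invr_eq1 => /eqP.
Qed.
End CartanBraiding.

(** * Commuting families of matrices *)

(** Induction on [n]: if some [rho x] is not scalar, one of its eigenspaces is nonzero and proper,
    and commutation makes it stable under the whole family. *)
Lemma common_eigenvector (k : closedFieldType) (I : Type) (n : nat)
    (rho : I -> 'M[k]_n) : (0 < n)%N ->
    (forall x y, comm_mx (rho x) (rho y)) ->
  exists2 v : 'rV_n, v != 0 & forall x, (v *m rho x <= v)%MS.
Proof.
elim/ltn_ind: n rho => n IHn rho n_gt0 rhoC.
have [scal|] := pselect (forall x, is_scalar_mx (rho x)).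
  exists (delta_mx 0 (Ordinal n_gt0)).
    apply/eqP => /matrixP/(_ 0 (Ordinal n_gt0))/eqP.
    by rewrite !mxE !eqxx oner_eq0.
  move=> x; have /is_scalar_mxP[c ->] := scal x.
  by rewrite mul_mx_scalar scalemx_sub.
case/existsNP=> x /negP nscal.
have [c] : exists c, root (char_poly (rho x)) c.
  by apply/closed_rootP; rewrite size_char_poly eqSS -lt0n.
rewrite -eigenvalue_root_char /eigenvalue.
set E := row_base (eigenspace (rho x) c) => E_neq0.
have E_free : row_free E by apply: row_base_free.
have EP m (W : 'M_(m, n)) : (W <= E)%MS = (W *m rho x == c *: W).
  by rewrite eq_row_base; apply/eigenspaceP/eqP.
have E_stable y : (E *m rho y <= E)%MS.
  rewrite EP -mulmxA rhoC mulmxA; have := submx_refl E; rewrite EP => /eqP->.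
  by rewrite -scalemxAl.
have r_gt0 : (0 < \rank (eigenspace (rho x) c))%N by rewrite lt0n mxrank_eq0.
have r_lt : (\rank (eigenspace (rho x) c) < n)%N.
  rewrite ltn_neqAle rank_leq_row andbT; apply: contra nscal => E_full.
  have : (1%:M <= E)%MS by rewrite eq_row_base submx_full.
  rewrite EP mul1mx => /eqP ->; rewrite scalemx1.
  exact: scalar_mx_is_scalar.
clearbody E.
(* [sigma y] is the matrix of [rho y] restricted to the eigenspace, in the basis [E]. *)
have [sigma sigmaE] : exists sigma, forall y, sigma y *m E = E *m rho y.
  by exists (fun y => E *m rho y *m pinvmx E) => y; rewrite mulmxKpV.
have [y z|v v_neq0 v_stable] := IHn _ r_lt sigma r_gt0.
  rewrite /comm_mx; apply: (row_free_inj E_free).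
  rewrite -!mulmxA !sigmaE !mulmxA !sigmaE.
  by rewrite -!mulmxA rhoC.
exists (v *m E) => [|y]; first by rewrite mulmx_free_eq0.
by rewrite -mulmxA -sigmaE mulmxA submxMr.
Qed.

(** * Modules over [A]: eigenvectors, stable subspaces and coordinates *)

Section Modules.
Variables (k : fieldType) (A : algType k) (M : lmodType A).

Lemma scale_algA (c : k) (b : A) (v : M) : (c *: b) *: v = c%:A *: (b *: v).
Proof. by rewrite scalerA mulr_algl. Qed.

Lemma scale_algC (c : k) (b : A) (v : M) : b *: (c%:A *: v) = c%:A *: (b *: v).
Proof. by rewrite !scalerA mulr_algl mulr_algr. Qed.

Lemma scale_algM (c d : k) (v : M) : c%:A *: (d%:A *: v) = (c * d)%:A *: v.
Proof. by rewrite scalerA mulr_algl scalerA. Qed.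

Lemma scale_alg_eq0 (c : k) (v : M) : v != 0 -> c%:A *: v = 0 -> c = 0.
Proof.
move=> v_neq0 cv0; apply: contraNeq v_neq0 => c_neq0.
by rewrite -[v]scale1r -[1]scale1r -(mulVf c_neq0) -scale_algM cv0 scaler0.
Qed.

(** Applying [b x - psi n x] to a relation kills its last term and multiplies the coefficient of
    [v t] by [psi t x - psi n x], nonzero for a suitable [x]. *)
Lemma eigenvectors_free (I : Type) (b : I -> A) (v : nat -> M)
    (psi : nat -> I -> k) :
    (forall t, v t != 0) -> (forall t x, b x *: v t = (psi t x)%:A *: v t) ->
    (forall s t, (s < t)%N -> exists x, psi s x != psi t x) ->
  forall n (c : nat -> k), \sum_(t < n) (c t)%:A *: v t = 0 ->
  forall t, (t < n)%N -> c t = 0.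
Proof.
move=> v_neq0 vE psi_neq; elim=> [//|n IHn] c.
rewrite big_ord_recr /= => cv0.
have c0 t : (t < n)%N -> c t = 0.
  move=> lt_tn; have [x x_neq] := psi_neq _ _ lt_tn.
  have : c t * (psi t x - psi n x) = 0.
    apply: (IHn (fun s => c s * (psi s x - psi n x))) lt_tn.
    transitivity ((b x - (psi n x)%:A) *:
        (\sum_(s < n) (c s)%:A *: v s + (c n)%:A *: v n));
      last by rewrite cv0 scaler0.
    rewrite scalerDr [X in _ = _ + X](_ : _ = 0).
      rewrite addr0 scaler_sumr; apply: eq_bigr => s _.
      by rewrite scale_algC scalerBl vE -!scalerBl scale_algM.
    by rewrite scale_algC scalerBl vE subrr scaler0.
  by move/eqP; rewrite mulf_eq0 subr_eq0 (negPf x_neq) orbF => /eqP.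
move=> t; rewrite ltnS leq_eqVlt => /orP[/eqP->|/c0//].
apply: (scale_alg_eq0 (v_neq0 n)); rewrite -[RHS]cv0 big1 ?add0r // => s _.
by rewrite c0 // scale0r scale0r.
Qed.

(** The elements of [A] that preserve [P] form a subalgebra containing the generators, so [P] is a
    submodule and simplicity applies. *)
Lemma generated_stable_subspace (Gamma : groupType) (u : Gamma -> A)
    (theta : nat) (a : 'I_theta -> A) (P : M -> Prop) :
    generated_by u a -> simple_module M ->
    P 0 -> (forall c v w, P v -> P w -> P (c%:A *: v + w)) ->
    (forall x v, P v -> P (u x *: v)) -> (forall i v, P v -> P (a i *: v)) ->
  (forall v, P v -> v = 0) \/ (forall v, P v).
Proof.
move=> gen [_ simp] P0 Plin Pu Pa.
have Pstable b v : P v -> P (b *: v).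
  pose S : {pred A} := fun b => `[< forall v, P v -> P (b *: v) >].
  suff /asboolP Sb : b \in S by exact: Sb.
  apply: gen => [|x|i]; rewrite ?inE; try by apply/asboolP; auto.
  split; first by apply/asboolP => w; rewrite scale1r.
    move=> c b1 b2 /asboolP P1 /asboolP P2; apply/asboolP => w Pw.
    by rewrite scalerDl scale_algA; apply: Plin; auto.
  move=> b1 b2 /asboolP P1 /asboolP P2; apply/asboolP => w Pw.
  by rewrite -scalerA; auto.
have [|all0|allP] := simp (fun v => `[< P v >]).
- split; first exact/asboolP.
  move=> b v w /asboolP Pv /asboolP Pw; apply/asboolP.
  by rewrite -[b *: v]scale1r -(scale1r (1 : A)); apply: Plin; auto.
- by left=> v Pv; apply: all0; apply/asboolP.
- by right=> v; apply/asboolP/allP.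
Qed.

Section Dimension.
Variables (n : nat) (v2r : restrict_scalars M -> 'rV[k]_n).
Hypothesis v2r_linear : linear v2r.
Hypothesis v2r_bij : bijective v2r.

(** The map [v2r] retyped on [M], so that the [A]-module structure is visible on its arguments. *)
Let f (v : M) : 'rV[k]_n := v2r v.

Fact coordD v w : f (v + w) = f v + f w.
Proof. by have := v2r_linear 1 v w; rewrite !scale1r. Qed.

Fact coord0 : f 0 = 0.
Proof. by apply: (addIr (f 0)); rewrite -coordD !add0r. Qed.

Fact coordZ c v : f (c%:A *: v) = c *: f v.
Proof. by have := v2r_linear c v 0; rewrite addr0 [v2r 0]coord0 addr0. Qed.

Fact coord_sum (I : Type) (r : seq I) (F : I -> M) :
  f (\sum_(i <- r) F i) = \sum_(i <- r) f (F i).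
Proof. exact: (big_morph f coordD coord0). Qed.

Fact coord_eq0 v : (f v == 0) = (v == 0).
Proof. by rewrite -(inj_eq (bij_inj v2r_bij)) [v2r 0]coord0. Qed.

(** The first [n.+1] vectors would give a row-free matrix with only [n] columns. *)
Lemma no_eigenvector_sequence (I : Type) (b : I -> A) (v : nat -> M)
    (psi : nat -> I -> k) :
    (forall t, v t != 0) -> (forall t x, b x *: v t = (psi t x)%:A *: v t) ->
    ~ (forall s t, (s < t)%N -> exists x, psi s x != psi t x).
Proof.
move=> v_neq0 vE psi_neq.
pose V := \matrix_(t < n.+1) f (v t).
have : row_free V.
  apply: inj_row_free => c cV0; apply/rowP => t; rewrite mxE.
  pose c' s := c 0 (inord s).
  have c'E (s : 'I_n.+1) : c' s = c 0 s by rewrite /c' inord_val.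
  rewrite -c'E; apply: (eigenvectors_free v_neq0 vE psi_neq) (ltn_ord t).
  apply/eqP; rewrite -coord_eq0 coord_sum -[X in _ == X]cV0 mulmx_sum_row.
  by apply/eqP/eq_bigr => s _; rewrite coordZ c'E rowK.
by rewrite /row_free => /eqP rkV; have := rank_leq_col V; rewrite rkV ltnn.
Qed.

(** Dividing by a nonzero coordinate of [v] reads off the scalar [c] linearly. *)
Lemma one_dimensional_line (v : M) : v != 0 ->
  (forall m, exists c : k, m = c%:A *: v) -> has_dimension M 1.
Proof.
move=> v_neq0 line.
have [i fvi] : exists i, f v 0 i != 0.
  apply/existsP/contraT; rewrite negb_exists => /forallP /= fv0.
  case/negP: v_neq0; rewrite -coord_eq0; apply/eqP/rowP => i.
  by rewrite mxE; apply/eqP; rewrite -[_ == _]negbK.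
pose h (m : restrict_scalars M) : 'rV[k]_1 := const_mx (f m 0 i / f v 0 i).
have hE c : h (c%:A *: v) = const_mx c.
  by rewrite /h coordZ mxE mulfK.
constructor; exists h.
  move=> c m1 m2; rewrite /h coordD coordZ; apply/rowP => j.
  by rewrite !mxE mulrDl mulrA.
exists (fun r : 'rV_1 => ((r 0 0)%:A *: v : M)).
  by move=> m; have [c ->] := line m; rewrite hE mxE.
by move=> r; rewrite hE; apply/rowP => j; rewrite mxE !ord1.
Qed.

End Dimension.
End Modules.

(** In coordinates the [b x] become commuting matrices, to which [common_eigenvector] applies. *)
Lemma common_weight_vector (k : closedFieldType) (A : algType k)
    (M : lmodType A) (I : Type) (b : I -> A) :
    finite_dimensional M -> (exists v : M, v != 0) ->
    (forall x y, b x * b y = b y * b x) ->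
  exists (v : M) (psi : I -> k),
    v != 0 /\ forall x, b x *: v = (psi x)%:A *: v.
Proof.
case=> n [[v2r v2r_lin v2r_bij]] [v0 v0_neq0] bC.
have [r2v v2rK r2vK] := v2r_bij.
have D v w : v2r ((v + w) : M) = v2r v + v2r w := coordD v2r_lin v w.
have Z c (v : M) : v2r (c%:A *: v) = c *: v2r v := coordZ v2r_lin c v.
have n_gt0 : (0 < n)%N.
  rewrite lt0n; apply: contra v0_neq0 => /eqP n0.
  rewrite -(coord_eq0 v2r_lin v2r_bij); apply/eqP/rowP => i.
  by have := ltn_ord i; rewrite [in X in (_ < X)%N]n0.
pose T x (r : 'rV[k]_n) : 'rV[k]_n := v2r (b x *: (r2v r : M)).
have r2v_lin c r s : r2v (c *: r + s) = (c%:A *: (r2v r : M) + r2v s) :> M.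
  by apply: (can_inj v2rK); rewrite D Z !r2vK.
have T_lin x : linear (T x).
  by move=> c r s; rewrite /T r2v_lin scalerDr D scale_algC Z.
pose TL x : {linear 'rV[k]_n -> 'rV[k]_n} :=
  HB.pack (T x) (GRing.isLinear.Build _ _ _ _ (T x) (T_lin x)).
have rhoE x r : r *m lin1_mx (TL x) = v2r (b x *: (r2v r : M)).
  by rewrite mul_rV_lin1.
have [x y|w w_neq0 w_stable] :=
  common_eigenvector (rho := fun x => lin1_mx (TL x)) n_gt0.
  apply/row_matrixP => i; rewrite !rowE !mulmxA !rhoE !v2rK.
  by rewrite !scalerA bC.
have [psi psiE] := choice (fun x => sub_rVP (w_stable x)).
exists (r2v w), psi; split.
  by rewrite -(coord_eq0 v2r_lin v2r_bij) r2vK.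
by move=> x; apply: (can_inj v2rK); rewrite -rhoE psiE Z r2vK.
Qed.

(** * One-dimensionality of the simple modules *)

Theorem theorem5p6 (k : closedFieldType) (A : algType k)
    (Gamma : groupType) (u : Gamma -> A)
    (theta : nat) (a : 'I_theta -> A) (chi : 'I_theta -> Gamma -> k)
    (g : 'I_theta -> Gamma) (C : 'M[int]_theta)
    (Gamma_abelian : abelian_group Gamma)
    (Gamma_units : embeds_in_units u)
    (A_generated : generated_by u a)
    (chi_nontrivial : forall i, nontrivial_character (chi i))
    (chi_action : forall x i, u x * a i * u (x^-1)%g = chi i x *: a i)
    (datum : datum_of_finite_cartan_type g chi C)
    (q_not_root : forall i, ~ is_root_of_unity (braiding g chi i i))
    (a_skew_commute : forall i j, ~~ connected C i j -> skew_commute (a i) (a j))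
    (M : lmodType A) :
  finite_dimensional M -> simple_module M -> has_dimension M 1.
Proof.
move=> M_fin M_simple.
have [[_ chi_char _ q_cartan _] C_finite] := datum.
have [_ u1 uM] := Gamma_units.
have [e [e_gt0 e_sym e_pos]] := integral_symmetrizer C_finite.
have q_neq0 i j : braiding g chi i j != 0 by exact: (proj1 (chi_char j)).
have uC x y : u x * u y = u y * u x by rewrite -!uM Gamma_abelian.
have ua x i : u x * a i = chi i x *: (a i * u x).
  rewrite -[LHS]mulr1 -u1 -[in u 1%g](mulVg x) uM mulrA chi_action.
  by rewrite scalerAl.
have au x i : a i * u x = (chi i x)^-1 *: (u x * a i).
  by rewrite ua scalerA mulVf ?scale1r ?(proj1 (chi_char i)).
have [v [psi [v_neq0 vE]]] := common_weight_vector M_fin (proj1 M_simple) uC.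
case: (M_fin) => n [[v2r v2r_lin v2r_bij]].
have a0 i (m : M) : a i *: m = 0.
  (* The common kernel of the [a j] in the component of [i]. *)
  pose P (m : M) := forall j, connected C i j -> a j *: m = 0.
  suff Pm : P m by exact: Pm (connect0 _ _).
  have [||||P0|//] := generated_stable_subspace A_generated M_simple (P := P).
  - by move=> j _; rewrite scaler0.
  - move=> c m1 m2 P1 P2 j ij.
    by rewrite scalerDr scale_algC P1 // P2 // scaler0 addr0.
  - move=> x w Pw j ij.
    by rewrite scalerA au scale_algA -scalerA Pw // !scaler0.
  - move=> l w Pw j ij; have [il|not_il] := boolP (connected C i l).
      by rewrite (Pw l) ?scaler0.
    have /a_skew_commute[omega _ jl] : ~~ connected C j l.
      by apply: contra not_il; apply: connect_trans.
    by rewrite scalerA jl scale_algA -scalerA Pw // !scaler0.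
  (* From here on the common kernel is zero. The default [i] is never taken at a nonzero [w], by
     [nextP]. *)
  pose next (w : M) := odflt i [pick j | connected C i j && (a j *: w != 0)].
  have nextP w : w != 0 -> connected C i (next w) /\ a (next w) *: w != 0.
    move=> w_neq0; rewrite /next; case: pickP => [j /andP[]//|none].
    case/eqP: w_neq0; apply: P0 => j ij.
    by apply/eqP; have := none j; rewrite ij => /negbFE.
  pose vs t := iter t (fun w => a (next w) *: w) v.
  have vs_neq0 t : vs t != 0 by elim: t => //= t /nextP[].
  pose psis t x := psi x * \prod_(0 <= s < t) chi (next (vs s)) x.
  have vsE t x : u x *: vs t = (psis t x)%:A *: vs t.
    elim: t => [|t IHt]; first by rewrite /psis big_geq // mulr1 vE.
    rewrite [vs _]/= scalerA ua scale_algA -scalerA IHt scale_algC.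
    by rewrite scale_algM /psis big_nat_recr //= mulrCA [chi _ _ * _]mulrC.
  case: (no_eigenvector_sequence v2r_lin v2r_bij vs_neq0 vsE) => s t lt_st.
  (* The letters applied between [vs s] and [vs t]: the two weights differ by the product of their
     characters. *)
  pose w := [seq next (vs r) | r <- index_iota s t].
  have [||l] := connected_word_nontrivial q_neq0 q_cartan e_gt0 e_sym e_pos
    (q_not_root i) (w := w).
  - by rewrite -size_eq0 size_map size_iota subn_eq0 -ltnNge.
  - by apply/allP => _ /mapP[r _ ->]; have [] := nextP _ (vs_neq0 r).
  rewrite big_map => w_neq1; exists (g l); apply: contra w_neq1 => /eqP.
  have -> : psis t (g l) =
      psis s (g l) * \prod_(s <= r < t) chi (next (vs r)) (g l).
    by rewrite /psis -mulrA -big_cat_nat //= ltnW.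
  (* Cancellation requires [psis s (g l)] to be nonzero: otherwise the unit [u (g l)] would kill
     [vs s]. *)
  rewrite -[LHS]mulr1 => /mulfI <- //; apply: contra (vs_neq0 s) => /eqP psis0.
  by rewrite -[vs s]scale1r -u1 -(mulVg (g l)) uM -scalerA vsE psis0
    !scale0r scaler0.
(* Since every [a i] acts as zero, the line through [v] is stable, hence all of [M]. *)
have [||||P0|line] := generated_stable_subspace A_generated M_simple
    (P := fun m => exists c : k, m = c%:A *: v).
- by exists 0; rewrite scale0r scale0r.
- move=> c _ _ [c1 ->] [c2 ->]; exists (c * c1 + c2).
  by rewrite !scalerDl scale_algM.
- by move=> x _ [c ->]; exists (c * psi x); rewrite scale_algC vE scale_algM.
- by move=> i _ [c ->]; exists 0; rewrite a0 !scale0r.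
- by case/eqP: v_neq0; apply: P0; exists 1; rewrite !scale1r.
exact: (one_dimensional_line v2r_lin v2r_bij v_neq0 line).
Qed.
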